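(* Let $X$ be a topological space. Each maximal ideal of $B_1^*(X)$ is a closed set in $B_1^*(X)$ with the uniform norm topology.
   Context: A Baire one function on a topological space $X$ is a function $f:X\to\mathbb{R}$ that is the pointwise limit of a sequence of continuous real-valued functions on $X$. $B_1^*(X)$ is the commutative ring, under pointwise operations, of all bounded Baire one functions on $X$. The uniform norm topology on $B_1^*(X)$ is the topology induced by the norm $\|f\|=\sup_{x\in X}|f(x)|$. *)

(* Defs.v *)
From HB Require Import structures.
From mathcomp Require Import all_boot all_order all_algebra.
From mathcomp Require Import all_classical all_reals.
From mathcomp Require Import topology normedtype sequences.

Set Implicit Arguments.
Unset Strict Implicit.
Unset Printing Implicit Defensive.

Import Order.TTheory GRing.Theory Num.Theory.
Import numFieldNormedType.Exports.

Local Open Scope classical_set_scope.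
Local Open Scope ring_scope.

Section ideals.
Context {A : comPzRingType}.
Implicit Types I J M : set A.

(* The library's [idealr_closed] is restricted to nontrivial rings and proper
   ideals; the ring of bounded Baire one functions on the empty space is
   trivial. *)
Definition is_ideal I : Prop :=
  [/\ I 0, (forall f g, I f -> I g -> I (f + g))
    & (forall a f, I f -> I (a * f))].

Definition is_maximal_ideal M : Prop :=
  [/\ is_ideal M, M <> setT
    & forall J, is_ideal J -> M `<=` J -> J = M \/ J = setT].

End ideals.

Definition baire_one {X : topologicalType} {R : realType} (f : X -> R) : Prop :=
  exists2 u : nat -> X -> R, (forall n, continuous (u n))
    & (forall x, u n x @[n --> \oo] --> f x).

Definition bounded_baire_one {X : topologicalType} {R : realType}
    : {pred X -> R} :=
  mem [set f : X -> R | baire_one f /\ bounded_fun f].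

Record B1star (X : topologicalType) (R : realType) := B1Star {
  B1star_fun :> X -> R ;
  _ : B1star_fun \in bounded_baire_one }.

HB.instance Definition _ (X : topologicalType) (R : realType) :=
  [isSub for @B1star_fun X R].
HB.instance Definition _ (X : topologicalType) (R : realType) :=
  [Choice of B1star X R by <:].

Section bounded_baire_one_closed.
Context {X : topologicalType} {R : realType}.
Implicit Types f g : X -> R.

Lemma baire_one_cst (c : R) : baire_one (cst c : X -> R).
Proof.
exists (fun=> cst c) => [n x|x]; first exact: cst_continuous.
exact: cvg_cst.
Qed.

Lemma baire_oneB f g : baire_one f -> baire_one g -> baire_one (f - g).
Proof.
move=> [u cu uf] [v cv vg]; exists (fun n => u n - v n) => [n x|x].
  by apply: continuousB; [exact: cu|exact: cv].
by apply: cvgB; [exact: uf|exact: vg].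
Qed.

Lemma baire_oneM f g : baire_one f -> baire_one g -> baire_one (f * g).
Proof.
move=> [u cu uf] [v cv vg]; exists (fun n => u n * v n) => [n x|x].
  by apply: continuousM; [exact: cu|exact: cv].
by apply: cvgM; [exact: uf|exact: vg].
Qed.

Lemma bounded_fun_bound f :
  bounded_fun f <-> exists M : R, forall x, `|f x| <= M.
Proof.
split=> [[M [_ Mf]]|[M Mf]].
  by exists (M + 1) => x; apply: (Mf (M + 1)) => //; rewrite ltrDl.
exists M; split=> [|m Mm x _ /=]; first exact: num_real.
exact: le_trans (Mf x) (ltW Mm).
Qed.

Lemma bounded_baire_one_subring :
  subring_closed (@bounded_baire_one X R).
Proof.
split=> [|f g|f g]; rewrite !inE /=.
- split; first exact: baire_one_cst.
  by apply/bounded_fun_bound; exists 1 => x; rewrite normr1.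
- move=> [bf /bounded_fun_bound[M Mf]] [bg /bounded_fun_bound[N Ng]].
  split; first exact: baire_oneB.
  apply/bounded_fun_bound; exists (M + N) => x.
  exact: le_trans (ler_normB _ _) (lerD (Mf x) (Ng x)).
- move=> [bf /bounded_fun_bound[M Mf]] [bg /bounded_fun_bound[N Ng]].
  split; first exact: baire_oneM.
  apply/bounded_fun_bound; exists (M * N) => x.
  rewrite [X in `|X|](_ : _ = f x * g x)// normrM.
  exact: ler_pM.
Qed.

Lemma bounded_baire_one_submod :
  submod_closed (@bounded_baire_one X R).
Proof.
have [b1 bB bM] := bounded_baire_one_subring.
split=> [|a f g bf bg]; first by rewrite -(subrr (1 : X -> R)) bB.
have bc (c : R) : cst c \in @bounded_baire_one X R.
  rewrite inE; split; first exact: baire_one_cst.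
  by apply/bounded_fun_bound; exists `|c|.
have -> : a *: f + g = (cst a : X -> R) * f - ((cst (-1) : X -> R) * g).
  by apply/funext => x; rewrite !fctE /= mulN1r opprK.
by apply: (bB); apply: bM.
Qed.

HB.instance Definition _ := GRing.isSubringClosed.Build _
  (@bounded_baire_one X R) bounded_baire_one_subring.
HB.instance Definition _ := GRing.isSubmodClosed.Build _ _
  (@bounded_baire_one X R) bounded_baire_one_submod.

End bounded_baire_one_closed.

HB.instance Definition _ (X : topologicalType) (R : realType) :=
  GRing.SubChoice_isSubComPzRing.Build (X -> R) (@bounded_baire_one X R)
    (B1star X R) bounded_baire_one_subring.
HB.instance Definition _ (X : topologicalType) (R : realType) :=
  GRing.SubZmodule_isSubLmodule.Build R (X -> R) (@bounded_baire_one X R)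
    (B1star X R) bounded_baire_one_submod.

Section sup_norm.
Context {X : topologicalType} {R : realType}.
Implicit Types f g : B1star X R.

(* This is 0 when X is empty, since [sup set0 = 0]. *)
Definition sup_norm f : R := sup (range (fun x => `|f x|)).

Lemma B1star_bounded f : bounded_fun f.
Proof. by have := valP f; rewrite inE => -[]. Qed.

Lemma sup_norm_ge f x : `|f x| <= sup_norm f.
Proof.
have /bounded_fun_bound[M Mf] := B1star_bounded f.
apply: ub_le_sup; last by exists x.
by exists M => _ [y _ <-].
Qed.

Lemma sup_norm_ge0 f : 0 <= sup_norm f.
Proof.
have [[x]|X0] := pselect (inhabited X).
  exact: le_trans (normr_ge0 (f x)) (sup_norm_ge f x).
rewrite /sup_norm [X in sup X](_ : _ = set0) ?sup0//.
by apply/seteqP; split => // t [x]; case: X0.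
Qed.

Lemma sup_norm_le f (M : R) : 0 <= M -> (forall x, `|f x| <= M) ->
  sup_norm f <= M.
Proof.
move=> M0 fM; have [[x]|X0] := pselect (inhabited X).
  by apply: ge_sup => [|_ [y _ <-]]; [exists `|f x|, x|exact: fM].
rewrite /sup_norm [X in sup X](_ : _ = set0) ?sup0//.
by apply/seteqP; split => // t [x]; case: X0.
Qed.

Lemma sup_normD f g : sup_norm (f + g) <= sup_norm f + sup_norm g.
Proof.
apply: sup_norm_le => [|x]; first by rewrite addr_ge0 ?sup_norm_ge0.
exact: le_trans (ler_normD _ _) (lerD (sup_norm_ge f x) (sup_norm_ge g x)).
Qed.

Lemma sup_normZ (a : R) f : sup_norm (a *: f) = `|a| * sup_norm f.
Proof.
have le_normZ b h : sup_norm (b *: h) <= `|b| * sup_norm h.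
  apply: sup_norm_le => [|x]; first by rewrite mulr_ge0 ?sup_norm_ge0.
  rewrite [X in `|X|](_ : _ = b * h x)// normrM.
  by rewrite ler_wpM2l ?sup_norm_ge.
apply/eqP; rewrite eq_le le_normZ /=.
have [->|a0] := eqVneq a 0; first by rewrite normr0 mul0r sup_norm_ge0.
rewrite -ler_pdivlMl ?normr_gt0// -normfV.
by have := le_normZ a^-1 (a *: f); rewrite scalerA mulVf// scale1r.
Qed.

Lemma sup_norm_eq0 f : sup_norm f = 0 -> f = 0.
Proof.
move=> f0; apply/val_inj/funext => x; apply/eqP.
by rewrite -normr_le0 -f0 sup_norm_ge.
Qed.

End sup_norm.

(* This installs both the norm and the topology it induces on [B1star X R]. *)
HB.instance Definition _ (X : topologicalType) (R : realType) :=
  @Lmodule_isNormed.Build R (B1star X R) sup_norm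
    sup_normD sup_normZ sup_norm_eq0.

(* Main.v *)
(* The closure of an ideal is an ideal, so a maximal ideal [M] that is not
   closed is dense and contains some [g] with [|1 - g| < 1/2].  Such a [g] is
   bounded below by [1/2], hence invertible: if the continuous [u n] converge
   pointwise to [g], the continuous [1 / max (u n) (1/2)] converge to [1 / g]. *)
Require Import Defs.
From mathcomp Require Import all_boot all_order all_algebra.
From mathcomp Require Import all_classical all_reals.
From mathcomp Require Import topology normedtype.
From mathcomp Require Import lra.

Section B1star_ideals.
Import Order.TTheory GRing.Theory Num.Theory.
Import numFieldNormedType.Exports.
Local Open Scope classical_set_scope.
Local Open Scope ring_scope.

Context {R : realType} {X : topologicalType}.
Implicit Types (f g : B1star X R) (I : set (B1star X R)).

Lemma is_ideal1 I : is_ideal I -> I 1 -> I = setT.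
Proof.
move=> [_ _ IM] I1; apply/seteqP; split => // f _.
by rewrite -[f]mulr1; apply: IM.
Qed.

(** Makes multiplication by a fixed element Lipschitz, so that closures of ideals absorb
    products. *)
Lemma sup_normM f g : sup_norm (f * g) <= sup_norm f * sup_norm g.
Proof.
apply: sup_norm_le => [|x]; first by rewrite mulr_ge0 ?sup_norm_ge0.
rewrite [X in `|X|](_ : _ = f x * g x)// normrM.
by rewrite ler_pM ?sup_norm_ge.
Qed.

Lemma closure_sup_normP I f :
  closure I f <-> forall e : R, 0 < e -> exists2 g, I g & sup_norm (f - g) < e.
Proof.
split=> [If e e0|If B /nbhs_ballP[e e0 eB]].
  have [g [Ig]] := If _ (nbhsx_ballx f e e0).
  by rewrite -ball_normE /= => fg; exists g.
have [g Ig fg] := If _ e0; exists g; split => //.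
by apply: eB; rewrite -ball_normE.
Qed.

Lemma is_ideal_closure I : is_ideal I -> is_ideal (closure I).
Proof.
move=> [I0 ID IM]; split.
- exact: subset_closure.
- move=> f g /closure_sup_normP If /closure_sup_normP Ig.
  apply/closure_sup_normP => e e0.
  have e20 : 0 < e / 2 by lra.
  have [f' If' ff'] := If _ e20.
  have [g' Ig' gg'] := Ig _ e20.
  exists (f' + g'); first exact: ID.
  rewrite opprD addrACA (le_lt_trans (sup_normD _ _))//; lra.
- move=> a f /closure_sup_normP If; apply/closure_sup_normP => e e0.
  (* The [+ 1] keeps the divisor of [e] positive even when [a] is zero. *)
  have a0 : 0 < sup_norm a + 1 by rewrite ltr_wpDl ?sup_norm_ge0.
  have [g Ig fg] := If _ (divr_gt0 e0 a0).
  exists (a * g); first exact: IM.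
  rewrite -mulrBr (le_lt_trans (sup_normM _ _))//.
  rewrite ltr_pdivlMr// in fg; apply: le_lt_trans fg.
  by rewrite mulrC ler_wpM2l ?sup_norm_ge0// lerDl.
Qed.

Lemma baire_oneV (h : X -> R) (c : R) : 0 < c -> (forall x, c <= h x) ->
  baire_one h -> baire_one (fun x => (h x)^-1).
Proof.
move=> c0 ch [u cu uh].
(* The approximants [u n] may vanish although [h] does not. Truncating at [c] makes inversion
   continuous on all of [R] and changes nothing at the values of [h], which are at least [c]. *)
pose inv_max y := (Num.max y c)^-1.
have cinv_max : continuous inv_max.
  move=> y; apply: (@continuousV _ _ (fun z => Num.max z c)).
    by rewrite gt_eqF// lt_max c0 orbT.
  by apply: (@continuous_max _ _ id (cst c)); [exact: id|exact: cst_continuous].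
exists (fun n => inv_max \o u n) => [n x|x].
  by apply: continuous_comp; [exact: cu|exact: cinv_max].
have -> : (h x)^-1 = inv_max (h x) by rewrite /inv_max max_l.
by apply: (continuous_cvg _ (cinv_max _)); exact: uh.
Qed.

(** The lower bound is uniform in [x], so the pointwise inverse is bounded by [c^-1] and stays in
    the ring. *)
Lemma B1star_invertible f (c : R) : 0 < c -> (forall x, c <= f x) ->
  exists g, g * f = 1.
Proof.
move=> c0 cf.
have f_gt0 x : 0 < f x by exact: lt_le_trans (cf x).
have fV : (fun x => (f x)^-1) \in @bounded_baire_one X R.
  have := valP f; rewrite !inE => -[bf _]; split; first exact: (baire_oneV _ c).
  apply/bounded_fun_bound; exists c^-1 => x.
  by rewrite gtr0_norm ?invr_gt0// lef_pV2 ?posrE.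
exists (B1Star fV); apply/val_inj/funext => x.
rewrite [LHS](_ : _ = (f x)^-1 * f x)//.
by rewrite mulVf// gt_eqF.
Qed.

Lemma is_ideal_dense I : is_ideal I -> closure I 1 -> I = setT.
Proof.
(* Any radius below 1 would do: it keeps [g] uniformly away from 0. *)
move=> idI /closure_sup_normP/(_ 2^-1).
rewrite invr_gt0 ltr0n => /(_ isT)[g Ig g1].
have g_ge x : 2^-1 <= g x.
  have := le_lt_trans (sup_norm_ge (1 - g) x) g1.
  rewrite [X in `|X|](_ : _ = 1 - g x)// ltr_norml => /andP[_]; lra.
have [|h hg] := B1star_invertible g 2^-1 _ g_ge; first by rewrite invr_gt0.
by apply: is_ideal1 => //; rewrite -hg; case: idI => _ _; apply.
Qed.

End B1star_ideals.

Theorem corollary2p3 (R : realType) (X : topologicalType)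
    (M : set (B1star X R)) (hM : is_maximal_ideal M) :
  closed M.
Proof.
have [idM MT maxM] := hM.
(* By maximality the closure is [M], or it is the whole ring; in the latter case it contains 1,
   which forces [M] to be the whole ring. *)
have [clM|clT] := maxM _ (is_ideal_closure M idM) (@subset_closure _ M).
  by rewrite -clM; exact: closed_closure.
by case: MT; apply: is_ideal_dense => //; rewrite clT.
Qed.
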